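(* Let $n$ be a natural number and $k$ a positive integer. Let $\mathcal{D}_n=\{2^{n-m}\cdot\mathsf{C}_{2^m}: 0\le m\le n,\ m\text{ even}\}$ and $\mathcal{D}_n'=\{2^{n-m}\cdot\mathsf{C}_{2^m}: 0\le m\le n,\ m\text{ odd}\}$. Then $\mathcal{D}_n$ and $\mathcal{D}_n'$ can be separated by a non-adaptive left $k$-query algorithm over $\mathbb{N}$ if and only if $k\ge n$.
   Context: Digraphs are finite structures $(V,R)$ with $V\neq\varnothing$ and $R\subseteq V\times V$; $\hom(F,D)$ is the number of homomorphisms from $F$ to $D$. $\mathsf{C}_p$ is the directed cycle of length $p$ (vertices $0,\dots,p-1$, edges $(i,i+1 \bmod p)$), and $r\cdot H$ is the disjoint union of $r$ copies of $H$. A non-adaptive left $k$-query algorithm over $\mathbb{N}$ is a pair $((F_1,\dots,F_k),X)$ with $F_i$ digraphs and $X\subseteq\mathbb{N}^k$; it accepts a digraph $D$ iff $(\hom(F_1,D),\dots,\hom(F_k,D))\in X$, and rejects it otherwise. An algorithm separates classes $\mathcal{A},\mathcal{B}$ if it accepts all structures in $\mathcal{A}$ and rejects all in $\mathcal{B}$, or vice versa. *)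

(* Defs.v *)
From mathcomp Require Import all_boot.

Set Implicit Arguments.
Unset Strict Implicit.
Unset Printing Implicit Defensive.

Record digraph := Digraph {
  vertex :> finType;
  arc : rel vertex;
  vertex_gt0 : 0 < #|vertex|
}.

Definition is_hom (F D : digraph) (f : {ffun F -> D}) : bool :=
  [forall x, forall y, arc x y ==> arc (f x) (f y)].

Definition hom (F D : digraph) : nat := #|[set f : {ffun F -> D} | is_hom f]|.

Lemma dicycle_gt0 (p : nat) : 0 < p -> 0 < #|'I_p|.
Proof. by rewrite card_ord. Qed.

(* For p = 1 this is a single vertex with a loop. *)
Definition dicycle (p : nat) (p_gt0 : 0 < p) : digraph :=
  @Digraph 'I_p [rel i j : 'I_p | val j == i.+1 %% p] (dicycle_gt0 p_gt0).

Lemma copies_gt0 (r : nat) (H : digraph) : 0 < r -> 0 < #|{: 'I_r * H}|.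
Proof. by rewrite card_prod card_ord muln_gt0 vertex_gt0 andbT. Qed.

Definition copies (r : nat) (r_gt0 : 0 < r) (H : digraph) : digraph :=
  @Digraph ('I_r * H)%type
    [rel u v : 'I_r * H | (u.1 == v.1) && arc u.2 v.2] (copies_gt0 H r_gt0).

Lemma pow2_gt0 (m : nat) : 0 < 2 ^ m.
Proof. by rewrite expn_gt0. Qed.

Definition copies_cycle (n m : nat) : digraph :=
  copies (pow2_gt0 (n - m)) (dicycle (pow2_gt0 m)).

Definition digraph_class := digraph -> Prop.

Definition even_class (n : nat) : digraph_class :=
  fun D => exists m : nat, [/\ m <= n, ~~ odd m & D = copies_cycle n m].

Definition odd_class (n : nat) : digraph_class :=
  fun D => exists m : nat, [/\ m <= n, odd m & D = copies_cycle n m].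

(* The accepting set is an arbitrary subset of N^k; no decidability is
   assumed. *)
Record left_algorithm (k : nat) := LeftAlgorithm {
  query : 'I_k -> digraph;
  accepting : k.-tuple nat -> Prop
}.

Definition accepts (k : nat) (A : left_algorithm k) (D : digraph) : Prop :=
  accepting A [tuple hom (query A i) D | i < k].

Definition rejects (k : nat) (A : left_algorithm k) (D : digraph) : Prop :=
  ~ accepts A D.

Definition separates (k : nat) (A : left_algorithm k)
    (P Q : digraph_class) : Prop :=
  ((forall D, P D -> accepts A D) /\ (forall D, Q D -> rejects A D)) \/
  ((forall D, Q D -> accepts A D) /\ (forall D, P D -> rejects A D)).

(* Main.v *)
(** Subtracting a fixed homomorphism from [F] to the cycle of length [p] turns
    the homomorphisms from [F] to [r] copies of that cycle into the maps from
    [F] to a set of size [r * p] that are constant along arcs.  Hence a query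
    [F] takes on the [n + 1] structures the value 0 or a value depending only
    on [F] and [n], and it is nonzero exactly for [m] below some threshold.
    One query therefore distinguishes at most one pair of consecutive values
    of [m], and all [n] such pairs must be distinguished.  Conversely the
    query given by the cycle of length [2 ^ i] has threshold [i]. *)

From mathcomp Require Import all_boot.
From mathcomp Require Import ssralg zmodp.
Require Import Defs.

Set Implicit Arguments.
Unset Strict Implicit.
Unset Printing Implicit Defensive.

Import GRing.Theory.

(** The injection may vary with the point. Two such bounds in opposite directions give an equality
    of counts without an explicit bijection. *)
Lemma leq_card_ffun_map (I T U : finType) (P : pred {ffun I -> T})
    (Q : pred {ffun I -> U}) (h : I -> T -> U) :
  (forall x, injective (h x)) ->
  (forall f, P f -> Q [ffun x => h x (f x)]) ->
  #|[set f | P f]| <= #|[set f | Q f]|.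
Proof.
move=> h_inj hPQ; pose H (f : {ffun I -> T}) := [ffun x => h x (f x)].
have H_inj : injective H.
  by move=> f g /ffunP eqH; apply/ffunP=> x; have := eqH x; rewrite !ffunE => /h_inj.
rewrite -(card_imset _ H_inj); apply/subset_leq_card/subsetP=> _ /imsetP[f Pf ->].
by move: Pf; rewrite !inE => /hPQ.
Qed.

Lemma is_homP (F D : digraph) (f : {ffun F -> D}) :
  reflect (forall x y, arc x y -> arc (f x) (f y)) (is_hom f).
Proof.
apply: (iffP forallP) => [fP x y xy | fP x].
  by have /forallP/(_ y)/implyP := fP x; apply.
by apply/forallP=> y; apply/implyP/fP.
Qed.

Lemma hom_gt0P (F D : digraph) :
  reflect (exists f : F -> D, forall x y, arc x y -> arc (f x) (f y))
          (0 < hom F D).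
Proof.
apply: (iffP card_gt0P) => [[f] | [f fP]].
  by rewrite inE => /is_homP fP; exists f.
by exists [ffun x => f x]; rewrite inE; apply/is_homP=> x y; rewrite !ffunE; apply: fP.
Qed.

(** With labels in [nat] rather than in ['I_p], one and the same [b] can be reduced to any divisor
    of the modulus. *)
Lemma hom_dicycle_gt0P (F : digraph) (p : nat) (p_gt0 : 0 < p) :
  reflect (exists b : F -> nat, forall x y, arc x y -> b y = (b x).+1 %[mod p])
          (0 < hom F (dicycle p_gt0)).
Proof.
apply: (iffP (hom_gt0P _ _)) => [[f fP] | [b bP]].
  by exists (fun x => val (f x)) => x y /fP /= /eqP ->; rewrite modn_mod.
exists (fun x => Ordinal (ltn_pmod (b x) p_gt0)) => x y /bP /= ->.
by rewrite -addn1 -[in X in _ == X]addn1 modnDml.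
Qed.

Lemma hom_dicycle_gt0_dvd (F : digraph) (p q : nat) (p_gt0 : 0 < p)
    (q_gt0 : 0 < q) :
  p %| q -> 0 < hom F (dicycle q_gt0) -> 0 < hom F (dicycle p_gt0).
Proof.
move=> dvd_pq /hom_dicycle_gt0P[b bP]; apply/hom_dicycle_gt0P; exists b => x y /bP.
by move=> /(congr1 (modn^~ p)); rewrite !modn_dvdm.
Qed.

Lemma hom_dicycle_dicycle_gt0 (p q : nat) (p_gt0 : 0 < p) (q_gt0 : 0 < q) :
  (0 < hom (dicycle p_gt0) (dicycle q_gt0)) = (q %| p).
Proof.
apply/idP/idP => [/hom_dicycle_gt0P[b bP] | dvd_qp]; last first.
  by apply/hom_dicycle_gt0P; exists val => x y /= /eqP ->; rewrite modn_dvdm.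
pose o i : 'I_p := Ordinal (ltn_pmod i p_gt0).
(* Since [i] is not bounded by [p], the walk may close up: after [p] arcs it is back at its start
   while [b] has grown by [p], so [p] is 0 modulo [q]. *)
have walk i : b (o i) = b (o 0) + i %[mod q].
  elim: i => [|i IHi]; first by rewrite addn0.
  rewrite (bP (o i) (o i.+1)) /=; last by rewrite -addn1 -[in X in _ == X]addn1 modnDml.
  by rewrite -addn1 -modnDml IHi modnDml addn1 addnS.
have op : o p = o 0 by apply: val_inj; rewrite /= modnn mod0n.
have /eqP := walk p; rewrite op -{1}[b (o 0)]addn0 eqn_modDl mod0n eq_sym.
by move=> dvd; rewrite /dvdn.
Qed.

(** These are the labellings of the weakly connected components of [F]. *)
Definition arc_constant (F : digraph) (q : nat) (f : {ffun F -> 'I_q}) : bool :=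
  [forall x, forall y, arc x y ==> (f x == f y)].

Definition card_arc_constant (F : digraph) (q : nat) : nat :=
  #|[set f : {ffun F -> 'I_q} | arc_constant f]|.

Lemma card_arc_constant_gt0 (F : digraph) (q : nat) :
  0 < q -> 0 < card_arc_constant F q.
Proof.
case: q => // q _; apply/card_gt0P; exists [ffun=> ord0]; rewrite inE.
by apply/forallP=> x; apply/forallP=> y; rewrite !ffunE eqxx implybT.
Qed.

(** Arcs become translations in a cyclic group, so homomorphisms can be subtracted. Writing [inZp 1]
    covers the loop [p = 0] too, where it is the zero of the trivial group. *)
Lemma arc_dicycleE (p : nat) (p_gt0 : 0 < p.+1) (i j : 'I_p.+1) :
  @arc (dicycle p_gt0) i j = (j == i + inZp 1)%R.
Proof. by rewrite -val_eqE /= modnDmr addn1. Qed.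

Lemma hom_copies_dicycle (F : digraph) (r p : nat) (r_gt0 : 0 < r)
    (p_gt0 : 0 < p) :
  hom F (copies r_gt0 (dicycle p_gt0)) =
    if 0 < hom F (dicycle p_gt0) then card_arc_constant F (r * p) else 0.
Proof.
case: ifP => [/hom_gt0P[b bP] | no_hom]; last first.
  apply/eqP; rewrite -leqn0 leqNgt; apply: contraFN no_hom => /hom_gt0P[f fP].
  by apply/hom_gt0P; exists (fun x => (f x).2) => x y /fP /= /andP[].
case: p => [//|p] in p_gt0 b bP *.
have -> : r * p.+1 = #|{: 'I_r * 'I_p.+1}| by rewrite card_prod !card_ord.
apply/eqP; rewrite eqn_leq; apply/andP; split.
(* Along an arc the copy index is unchanged, while the cycle coordinate and [b] both grow by 1, so
   their difference is constant. *)
- pose h (x : F) (v : 'I_r * 'I_p.+1) := enum_rank (v.1, v.2 - b x)%R.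
  apply: (@leq_card_ffun_map _ (copies r_gt0 (dicycle p_gt0)) _
            (@is_hom F _) (@arc_constant F _) h) => [x [a c] [a' c'] | f /is_homP fP].
    move=> /enum_rank_inj/eqP; rewrite xpair_eqE => /andP[/eqP /= -> /eqP eq_c].
    by congr pair; apply: addIr eq_c.
  apply/forallP=> x; apply/forallP=> y; apply/implyP=> xy; rewrite !ffunE /h.
  have /andP[/eqP -> ] := fP _ _ xy; rewrite arc_dicycleE => /eqP ->.
  have := bP _ _ xy; rewrite arc_dicycleE => /eqP ->.
  by rewrite opprD addrACA subrr addr0.
(* The inverse relabelling: adding [b] back turns a constant label into a step along the cycle. *)
- pose h (x : F) (i : 'I_#|{: 'I_r * 'I_p.+1}|) :=
    ((enum_val i).1, (enum_val i).2 + b x)%R.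
  apply: (@leq_card_ffun_map _ _ (copies r_gt0 (dicycle p_gt0))
            (@arc_constant F _) (@is_hom F _) h) => [x i j | f /forallP fP].
    move=> /eqP; rewrite xpair_eqE => /andP[/eqP eq1 /eqP eq2]; apply: enum_val_inj.
    by apply/eqP; rewrite -pair_eqE /pair_eq eq1 (addIr _ eq2) !eqxx.
  apply/is_homP=> x y xy; rewrite !ffunE /h.
  have /forallP/(_ y)/implyP/(_ xy)/eqP -> := fP x.
  have := bP _ _ xy; rewrite arc_dicycleE => /eqP ->.
  apply/andP; split; first exact: eqxx.
  by apply: (etrans (arc_dicycleE _ _ _)); rewrite addrA eqxx.
Qed.

Lemma hom_copies_cycle (F : digraph) (n m : nat) : m <= n ->
  hom F (copies_cycle n m) =
    if 0 < hom F (dicycle (pow2_gt0 m)) then card_arc_constant F (2 ^ n) else 0.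
Proof. by move=> le_mn; rewrite hom_copies_dicycle -expnD subnK. Qed.

(** The two values can differ only if exactly one is 0, and divisibility of the cycle lengths
    decides which one. *)
Lemma hom_copies_cycle_neq (F : digraph) (n m : nat) : m < n ->
  hom F (copies_cycle n m) != hom F (copies_cycle n m.+1) ->
  (0 < hom F (dicycle (pow2_gt0 m))) && ~~ (0 < hom F (dicycle (pow2_gt0 m.+1))).
Proof.
move=> lt_mn; rewrite !hom_copies_cycle ?(ltnW lt_mn) //.
have := @hom_dicycle_gt0_dvd F _ _ (pow2_gt0 m) (pow2_gt0 m.+1) (dvdn_exp2l 2 (leqnSn m)).
by do 2![case: (0 < hom F _)] => //=; rewrite ?eqxx // => /(_ isT).
Qed.

(** The query with index [m], the smaller exponent, tells them apart: its value is positive at [m]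
    and 0 at [m']. *)
Lemma copies_cycle_distinguished (n k m m' : nat) (q : 'I_k -> digraph) :
  (forall i : 'I_k, q i = dicycle (pow2_gt0 i)) -> n <= k -> m < m' -> m' <= n ->
  [tuple hom (q i) (copies_cycle n m) | i < k] <>
  [tuple hom (q i) (copies_cycle n m') | i < k].
Proof.
move=> qE le_nk lt_mm' le_m'n.
have lt_mk : m < k by apply: leq_trans lt_mm' (leq_trans le_m'n le_nk).
move=> /(congr1 (fun t => tnth t (Ordinal lt_mk))); rewrite !tnth_mktuple qE /=.
rewrite !hom_copies_cycle ?(leq_trans (ltnW lt_mm')) // !hom_dicycle_dicycle_gt0.
rewrite dvdnn dvdn_Pexp2l // leqNgt lt_mm' /= => eq0.
by have := card_arc_constant_gt0 (dicycle (pow2_gt0 m)) (pow2_gt0 n); rewrite eq0.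
Qed.

(** Consecutive exponents have opposite parity, so the two structures lie in opposite classes and
    cannot have equal answer vectors. *)
Lemma separates_distinguishes (n k m : nat) (A : left_algorithm k) :
  separates A (even_class n) (odd_class n) -> m < n ->
  exists i, hom (query A i) (copies_cycle n m) !=
            hom (query A i) (copies_cycle n m.+1).
Proof.
move=> sepA lt_mn; apply/existsP; rewrite -negb_forall; apply/negP=> /forallP eq_hom.
have acc_eq : accepts A (copies_cycle n m) <-> accepts A (copies_cycle n m.+1).
  rewrite /accepts; set s := mktuple _; set t := mktuple _.
  suff -> : s = t by [].
  by apply: eq_from_tnth => i; rewrite !tnth_mktuple; apply/eqP/eq_hom.
have evenP j : j <= n -> ~~ odd j -> even_class n (copies_cycle n j) by exists j.
have oddP j : j <= n -> odd j -> odd_class n (copies_cycle n j) by exists j.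
have [odd_m | even_m] := boolP (odd m).
  have od := oddP m (ltnW lt_mn) odd_m.
  have ev : even_class n (copies_cycle n m.+1) by apply: evenP; rewrite //= odd_m.
  by case: sepA => -[acc rej]; [apply: (rej _ od) | apply: (rej _ ev)];
    apply/acc_eq/acc.
have ev := evenP m (ltnW lt_mn) even_m.
have od : odd_class n (copies_cycle n m.+1) by apply: oddP; rewrite //= even_m.
by case: sepA => -[acc rej]; [apply: (rej _ od) | apply: (rej _ ev)];
  apply/acc_eq/acc.
Qed.

Theorem theorem13 (n k : nat) (k_gt0 : 0 < k) :
  (exists A : left_algorithm k, separates A (even_class n) (odd_class n)) <->
  n <= k.
Proof.
split=> [[A sepA] | le_nk].
  have [f fP] := fin_all_exists (fun m : 'I_n => separates_distinguishes sepA (ltn_ord m)).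
  suff f_inj : injective f by have := leq_card f f_inj; rewrite !card_ord.
  suff f_neq (m m' : 'I_n) : m < m' -> f m != f m'.
    move=> m m' eq_f; apply: val_inj; case: (ltngtP m m') => // /f_neq;
      by rewrite eq_f eqxx.
  move=> lt_mm'; apply/eqP=> eq_f.
  (* A query shared by [m < m'] would map to the cycle of length [2 ^ m'], hence to that of length
     [2 ^ m.+1], which its choice for [m] forbids. *)
  have /andP[_ /negP] := hom_copies_cycle_neq (ltn_ord m) (fP m); apply.
  have /andP[] := hom_copies_cycle_neq (ltn_ord m') (fP m'); rewrite -eq_f => hom_m' _.
  exact: hom_dicycle_gt0_dvd (dvdn_exp2l 2 lt_mm') hom_m'.
pose q (i : 'I_k) := dicycle (pow2_gt0 i).
pose values m := [tuple hom (q i) (copies_cycle n m) | i < k].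
(* Accepting exactly the answer vectors of the even class leaves only to show that no odd exponent
   yields one of them. *)
exists (LeftAlgorithm q (fun t => exists m, [/\ m <= n, ~~ odd m & t = values m])).
left; split=> _ [m [le_mn m_par ->]]; first by exists m.
move=> [m' [le_m'n m'_par /esym eq_val]].
case: (ltngtP m m') => [lt_mm' | lt_m'm | eq_mm'].
- exact: (copies_cycle_distinguished _ le_nk lt_mm' le_m'n) (esym eq_val).
- exact: (copies_cycle_distinguished _ le_nk lt_m'm le_mn) eq_val.
- by rewrite -eq_mm' m_par in m'_par.
Qed.
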